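(* Let $U$ and $A$ be algebras over a field $k$ and let $H = U\otimes A$ be an algebra structure on the tensor product of their underlying vector spaces which satisfies $$(u\otimes a)(u'\otimes a') = uu'\otimes aa' \quad\text{whenever } a = 1 \text{ or } u' = 1 .$$ Let $\chi\in\mathrm{Alg}(A,k)$, $\rho\in\mathrm{Alg}(U,k)$, and let $\Psi: A\otimes U\to k$ be the bilinear form $$\Psi(a,u)=(\rho\otimes\chi)\big((1\otimes a)(u\otimes1)\big).$$ Then: a) $\Psi(a,u)=\rho((1\otimes a)\cdot_\chi u)=\chi(a\cdot_\rho(u\otimes1))$ for all $a\in A$, $u\in U$. b) $\Psi(a\cdot_\rho h,u)=\Psi(a,h\cdot_\chi u)$ for all $a\in A$, $h\in H$, $u\in U$; that is, $\Psi$ is $H$-balanced. c) $A^\perp=I(\rho,\chi)$ and thus $U/A^\perp=L(\rho,\chi)$. Furthermore there is an isomorphism of left $H$-modules $L(\rho,\chi)\to U\cdot_\rho\chi$ given by $u+I(\rho,\chi)\mapsto\Psi_r(u)=u\cdot_\rho\chi$ for all $u\in U$. d) $U^\perp=J(\chi,\rho)$ and thus $A/U^\perp=R(\chi,\rho)$. Furthermore there is an isomorphism of right $H$-modules $R(\chi,\rho)\to\rho\cdot_\chi A$ given by $a+J(\chi,\rho)\mapsto\Psi_\ell(a)=\rho\cdot_\chi a$ for all $a\in A$. e) There is a non-singular $H$-balanced bilinear form $\overline\Psi: R(\chi,\rho)\otimes L(\rho,\chi)\to k$ determined by $\overline\Psi\circ(\pi_{(\chi,\rho)}\otimes\pi_{(\rho,\chi)})=\Psi$,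 where $\pi_{(\chi,\rho)}: A\to R(\chi,\rho)$ and $\pi_{(\rho,\chi)}: U\to L(\rho,\chi)$ are the projections.
   Context: Algebras are associative and unital; $\otimes=\otimes_k$; $\mathrm{Alg}(X,k)$ is the set of unital algebra homomorphisms $X\to k$. $U$ and $A$ are regarded as subalgebras of $H$ via $u\mapsto u\otimes 1$ and $a\mapsto 1\otimes a$. $U_\chi$ is the left $H$-module with underlying space $U$ and action $(u\otimes a)\cdot_\chi u' = u\big((\mathrm{id}_U\otimes\chi)((1\otimes a)(u'\otimes 1))\big)$. $A_\rho$ is the right $H$-module with underlying space $A$ and action $a\cdot_\rho(u\otimes a') = \big((\rho\otimes\mathrm{id}_A)((1\otimes a)(u\otimes 1))\big)a'$. $I(\rho,\chi)$ is the sum of all left $H$-submodules of $U_\chi$ contained in $\mathrm{Ker}\,\rho$ and $L(\rho,\chi)=U_\chi/I(\rho,\chi)$. $J(\chi,\rho)$ is the sum of all right $H$-submodules of $A_\rho$ contained in $\mathrm{Ker}\,\chi$ and $R(\chi,\rho)=A_\rho/J(\chi,\rho)$. $U^*$ is a right $H$-module by $(u^*\cdot_\chi h)(u)=u^*(h\cdot_\chi u)$ and $A^*$ is a left $H$-module by $(h\cdot_\rho a^* )(a)=a^*(a\cdot_\rho h)$. $U\cdot_\rho\chi=\{(u\otimes1)\cdot_\rho\chi : u\in U\}\subseteq A^*$ and $\rho\cdot_\chi A=\{\rho\cdot_\chi(1\otimes a): a\in A\}\subseteq U^*$. $\Psi_\ell: A\to U^*$ and $\Psi_r: U\to A^*$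 are given by $\Psi_\ell(a)(u)=\Psi(a,u)=\Psi_r(u)(a)$. $A^\perp=\{u\in U: \Psi(A,u)=(0)\}$ and $U^\perp=\{a\in A:\Psi(a,U)=(0)\}$. A bilinear form $\beta:X\otimes Y\to k$ is non-singular if both induced maps $X\to Y^*$ and $Y\to X^*$ are one-one; for $X$ a right and $Y$ a left $H$-module it is $H$-balanced if $\beta(x\cdot h,y)=\beta(x,h\cdot y)$ for all $x,h,y$. *)

(* Defs.v *)
From HB Require Import structures.
From mathcomp Require Import all_boot all_algebra.
From mathcomp Require Import boolp.

Set Implicit Arguments.
Unset Strict Implicit.
Unset Printing Implicit Defensive.

Import GRing.Theory.
Local Open Scope ring_scope.

(* Right modules over [B] are left modules over the converse ring [B^c]. *)
Definition ract (B : pzRingType) (X : lmodType B^c) (x : X) (h : B) : X :=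
  (h : B^c) *: x.

(* Restriction of scalars along [f]. *)
Definition restr (k B : pzRingType) (f : {rmorphism k -> B}) (M : lmodType B) :
  Type := M.

Section Restriction.
Variables (k B : pzRingType) (f : {rmorphism k -> B}) (M : lmodType B).

HB.instance Definition _ := GRing.Zmodule.copy (restr f M) M.

Definition restr_scale (c : k) (m : restr f M) : restr f M := f c *: (m : M).

Fact restr_scaleA c d m :
  restr_scale c (restr_scale d m) = restr_scale (c * d) m.
Proof. by rewrite /restr_scale scalerA rmorphM. Qed.
Fact restr_scale1 : left_id 1 restr_scale.
Proof. by move=> m; rewrite /restr_scale rmorph1 scale1r. Qed.
Fact restr_scaleDr : right_distributive restr_scale +%R.
Proof. by move=> c m n; rewrite /restr_scale scalerDr. Qed.
Fact restr_scaleDl m : {morph restr_scale^~ m : c d / c + d}.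
Proof. by move=> c d; rewrite /restr_scale rmorphD scalerDl. Qed.

HB.instance Definition _ := GRing.Zmodule_isLmodule.Build k (restr f M)
  restr_scaleA restr_scale1 restr_scaleDr restr_scaleDl.

End Restriction.

Section ScalarsOfAlgebra.
Variables (k : comNzRingType) (B : algType k).

Definition in_algc (c : k) : B^c := c%:A : B.

Fact in_algc_zmod : zmod_morphism in_algc.
Proof. by move=> c d; rewrite /in_algc scalerBl. Qed.
Fact in_algc_monoid : monoid_morphism in_algc.
Proof.
split; first by rewrite /in_algc scale1r.
move=> c d; rewrite mulrC /in_algc.
by rewrite -[RHS]/((d%:A : B) * c%:A) -scalerAl mul1r scalerA.
Qed.

HB.instance Definition _ := GRing.isZmodMorphism.Build k B^c in_algc in_algc_zmod.
HB.instance Definition _ := GRing.isMonoidMorphism.Build k B^c in_algc in_algc_monoid.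

End ScalarsOfAlgebra.

Section Submodules.
Variables (R : pzRingType) (M : lmodType R).

Definition submod_sum (F : submodClosed M -> Prop) : {pred M} :=
  fun x => `[< exists s : seq M,
    (forall y, y \in s -> exists2 N : submodClosed M, F N & y \in N)
    /\ x = \sum_(y <- s) y >].

Fact submod_sum_closed F : subsemimod_closed (submod_sum F).
Proof.
split; first split.
- by apply/asboolP; exists [::]; rewrite big_nil; split.
- move=> x y /asboolP[s [Hs ->]] /asboolP[t [Ht ->]].
  apply/asboolP; exists (s ++ t); rewrite big_cat; split=> // z.
  by rewrite mem_cat => /orP[/Hs | /Ht].
- move=> a x /asboolP[s [Hs ->]]; apply/asboolP.
  exists [seq a *: y | y <- s]; rewrite big_map scaler_sumr; split=> // z.
  by case/mapP=> y /Hs[N FN yN] ->; exists N => //; apply: rpredZ.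
Qed.

HB.instance Definition _ F :=
  GRing.isSubSemiModClosed.Build R M (submod_sum F) (submod_sum_closed F).

Variable S : submodClosed M.

Definition submod_pred : {pred M} := [pred x | x \in S].

Fact submod_pred_zmod_closed : zmod_closed submod_pred.
Proof.
split=> [|x y]; rewrite !inE; first exact: rpred0.
by move=> Sx Sy; rewrite rpredD // -scaleN1r rpredZ.
Qed.

HB.instance Definition _ :=
  GRing.isZmodClosed.Build M submod_pred submod_pred_zmod_closed.

Definition quot_module : Type := Quotient.quot submod_pred.

HB.instance Definition _ := GRing.Zmodule.on quot_module.

Definition quot_pi (x : M) : quot_module :=
  (\pi_(Quotient.quot submod_pred) x)%qT.

Fact quot_piK (q : quot_module) : quot_pi (generic_quotient.repr q) = q.
Proof. exact: generic_quotient.reprK. Qed.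

Fact quot_pi_eq x y : (quot_pi x == quot_pi y) = (x - y \in S).
Proof. by rewrite -Quotient.idealrBE. Qed.

Fact quot_pi_zmod : zmod_morphism quot_pi.
Proof. by move=> x y; rewrite /quot_pi raddfB. Qed.

Definition quot_scale (a : R) (q : quot_module) : quot_module :=
  quot_pi (a *: generic_quotient.repr q).

Fact quot_scale_pi a x : quot_scale a (quot_pi x) = quot_pi (a *: x).
Proof.
apply/eqP; rewrite quot_pi_eq -scalerBr rpredZ //.
by rewrite -quot_pi_eq quot_piK.
Qed.

HB.instance Definition _ :=
  GRing.isZmodMorphism.Build M quot_module quot_pi quot_pi_zmod.

Fact quot_scaleA a b q : quot_scale a (quot_scale b q) = quot_scale (a * b) q.
Proof. by rewrite -[q]quot_piK !quot_scale_pi scalerA. Qed.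
Fact quot_scale1 : left_id 1 quot_scale.
Proof. by move=> q; rewrite -[q]quot_piK !quot_scale_pi scale1r. Qed.
Fact quot_scaleDr : right_distributive quot_scale +%R.
Proof.
move=> a p q; rewrite -[p]quot_piK -[q]quot_piK -raddfD !quot_scale_pi -raddfD.
by rewrite scalerDr.
Qed.
Fact quot_scaleDl q : {morph quot_scale^~ q : a b / a + b}.
Proof.
by move=> a b; rewrite -[q]quot_piK !quot_scale_pi -raddfD scalerDl.
Qed.

HB.instance Definition _ := GRing.Zmodule_isLmodule.Build R quot_module
  quot_scaleA quot_scale1 quot_scaleDr quot_scaleDl.

Fact quot_pi_scalable : scalable quot_pi.
Proof. by move=> a x; rewrite -quot_scale_pi. Qed.

HB.instance Definition _ :=
  GRing.isScalable.Build R M quot_module *:%R quot_pi quot_pi_scalable.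

End Submodules.

(* [f], a morphism of modules into [N], is an isomorphism onto the submodule
   [S] of [N]. *)
Definition lmod_iso_onto (R : pzRingType) (M N : lmodType R) (S : {pred N})
    (f : {linear M -> N}) : Prop :=
  [/\ submod_closed S, injective f & forall y, y \in S <-> exists x, f x = y].

Section Dual.
Variables (k : comNzRingType) (V : lmodType k).

Definition dual : Type := {linear V -> k^o}.

Definition dual_fun (f : dual) : V -> k := f : {linear V -> k^o}.
Coercion dual_fun : dual >-> Funclass.

Fact dualP (f g : dual) : f =1 g -> f = g.
Proof.
case: f => f [[f0] [fZ]]; case: g => g [[g0] [gZ]] fg.
have {}fg : f = g by apply: funext => x; exact: fg.
case: g / fg in g0 gZ *.
by rewrite (Prop_irrelevance f0 g0) (Prop_irrelevance fZ gZ).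
Qed.

HB.instance Definition _ := gen_eqMixin dual.
HB.instance Definition _ := gen_choiceMixin dual.

Definition dual_zero : dual := (\0 : V -> k^o) : {linear V -> k^o}.
Definition dual_opp (f : dual) : dual := (\- f : V -> k^o) : {linear V -> k^o}.
Definition dual_add (f g : dual) : dual :=
  (f \+ g : V -> k^o) : {linear V -> k^o}.

Fact dual_addA : associative dual_add.
Proof. by move=> f g h; apply: dualP => x; exact: addrA. Qed.
Fact dual_addC : commutative dual_add.
Proof. by move=> f g; apply: dualP => x; exact: addrC. Qed.
Fact dual_add0 : left_id dual_zero dual_add.
Proof. by move=> f; apply: dualP => x; exact: add0r. Qed.
Fact dual_addN : left_inverse dual_zero dual_opp dual_add.
Proof. by move=> f; apply: dualP => x; exact: addNr. Qed.

HB.instance Definition _ :=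
  GRing.isZmodule.Build dual dual_addA dual_addC dual_add0 dual_addN.

Fact dual_addE (f g : dual) x : (f + g) x = f x + g x. Proof. by []. Qed.

End Dual.

Section BilinearForms.
Variables (k : comNzRingType) (X Y : lmodType k).
Variable (beta : {bilinear X -> Y -> k^o}).

Definition curryl (x : X) : dual Y := beta x : {linear Y -> k^o}.
Definition curryr (y : Y) : dual X := applyr beta y : {linear X -> k^o}.

Definition nonsingular : Prop := injective curryl /\ injective curryr.

End BilinearForms.

Definition balanced (B : pzRingType) (X : lmodType B^c) (Y : lmodType B) (T : Type)
    (beta : X -> Y -> T) : Prop :=
  forall x h y, beta (ract x h) y = beta x (h *: y).

Definition is_tensor_product (k : comNzRingType) (U V W : lmodType k)
    (t : {bilinear U -> V -> W}) : Prop :=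
  forall (X : lmodType k) (f : {bilinear U -> V -> X}),
    exists g : {linear W -> X}, (forall u v, g (t u v) = f u v) /\
      forall g' : {linear W -> X}, (forall u v, g' (t u v) = f u v) -> g' =1 g.

(* An algebra structure on the vector space [U (x) A]; [tens H u a] is the
   pure tensor. *)
Record tensor_algebra (k : fieldType) (U A : algType k) := TensorAlgebra {
  tensor_alg :> algType k;
  tens : {bilinear U -> A -> tensor_alg};
  tens_universal : is_tensor_product tens;
  tensM : forall u a u' a', a = 1 \/ u' = 1 ->
    tens u a * tens u' a' = tens (u * u') (a * a')
}.

(* [U_chi] and [A_rho] have underlying spaces [U] and [A], [Udual] and [Adual]
   have underlying spaces [U^*] and [A^*]; the module structures, declared
   below, depend on the remaining parameters. *)
Definition U_chi (k : fieldType) (U A : algType k) (H : tensor_algebra U A)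
  (chi : {lrmorphism A -> k^o}) : Type := U.
Definition A_rho (k : fieldType) (U A : algType k) (H : tensor_algebra U A)
  (rho : {lrmorphism U -> k^o}) : Type := A.
Definition Udual (k : fieldType) (U A : algType k) (H : tensor_algebra U A)
  (chi : {lrmorphism A -> k^o}) : Type := dual U.
Definition Adual (k : fieldType) (U A : algType k) (H : tensor_algebra U A)
  (rho : {lrmorphism U -> k^o}) : Type := dual A.

Section TensorAlgebra.
Variables (k : fieldType) (U A : algType k) (H : tensor_algebra U A).

Local Notation "u *t a" := (tens H u a) (at level 40).

Section Lift.
Variables (X : lmodType k) (f : {bilinear U -> A -> X}).

Definition tlift : {linear H -> X} := projT1 (cid (tens_universal H f)).

Fact tliftE u a : tlift (u *t a) = f u a.
Proof. by rewrite /tlift; case: cid => g [gE _] /=. Qed.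

End Lift.

Fact tens_ext (X : lmodType k) (g g' : H -> X) : linear g -> linear g' ->
  (forall u a, g (u *t a) = g' (u *t a)) -> g =1 g'.
Proof.
move=> gL g'L gg'.
pose G : {linear H -> X} := HB.pack g (GRing.isLinear.Build _ _ _ _ g gL).
pose G' : {linear H -> X} := HB.pack g' (GRing.isLinear.Build _ _ _ _ g' g'L).
pose f : U -> A -> X := fun u a => G' (u *t a).
have bf : bilinear_for (GRing.Scale.Law.clone _ _ *:%R _)
    (GRing.Scale.Law.clone _ _ *:%R _) f.
  by split=> [a | u] c x y; rewrite /f ?linearPl ?linearPr linearP.
pose F : {bilinear U -> A -> X} :=
  HB.pack f (bilinear_isBilinear.Build _ _ _ _ _ _ f bf).
have [h [_ hU]] := tens_universal H F => x.
by rewrite -[g x]/(G x) (hU G) // -[g' x]/(G' x) (hU G').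
Qed.

Fact tens1 : 1 *t 1 = 1.
Proof.
suff E : *%R (1 *t 1) =1 (@idfun H) by rewrite -[LHS]mulr1 E.
apply: tens_ext => [c x y | c x y | u a] //=; first by rewrite mulrDr scalerAr.
by rewrite tensM ?mul1r //; left.
Qed.

(* The map [f (x) g], composed with the identification [X (x) k = X]. *)
Section TensorWithFormRight.
Variables (X : lmodType k) (f : {linear U -> X}) (g : {linear A -> k^o}).

Definition scaler_fun (u : U) (a : A) : X := (g a : k) *: f u.

Fact scaler_fun_bilinear : bilinear_for (GRing.Scale.Law.clone _ _ *:%R _)
  (GRing.Scale.Law.clone _ _ *:%R _) scaler_fun.
Proof.
split=> [a | u] c x y; rewrite /scaler_fun linearP.
- by rewrite scalerDr /= !scalerA mulrC.
- by rewrite [LHS](@scalerDl k X (f u) (c * g x) (g y)) /= scalerA.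
Qed.

HB.instance Definition _ :=
  bilinear_isBilinear.Build k U A X *:%R *:%R scaler_fun scaler_fun_bilinear.

Definition tensr : {linear H -> X} := tlift scaler_fun.

Fact tensrE u a : tensr (u *t a) = (g a : k) *: f u.
Proof. exact: tliftE. Qed.

End TensorWithFormRight.

(* The map [f (x) g], composed with the identification [k (x) Y = Y]. *)
Section TensorWithFormLeft.
Variables (Y : lmodType k) (f : {linear U -> k^o}) (g : {linear A -> Y}).

Definition scalel_fun (u : U) (a : A) : Y := (f u : k) *: g a.

Fact scalel_fun_bilinear : bilinear_for (GRing.Scale.Law.clone _ _ *:%R _)
  (GRing.Scale.Law.clone _ _ *:%R _) scalel_fun.
Proof.
split=> [a | u] c x y; rewrite /scalel_fun linearP.
- by rewrite [LHS](@scalerDl k Y (g a) (c * f x) (f y)) /= scalerA.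
- by rewrite scalerDr /= !scalerA mulrC.
Qed.

HB.instance Definition _ :=
  bilinear_isBilinear.Build k U A Y *:%R *:%R scalel_fun scalel_fun_bilinear.

Definition tensl : {linear H -> Y} := tlift scalel_fun.

Fact tenslE u a : tensl (u *t a) = (f u : k) *: g a.
Proof. exact: tliftE. Qed.

End TensorWithFormLeft.

Section LeftModule.
Variable chi : {lrmorphism A -> k^o}.

Local Notation id_chi := (tensr (idfun : {linear U -> U}) chi).

Definition Uact_fun (u' u : U) (a : A) : U := u * id_chi ((1 *t a) * (u' *t 1)).

Fact Uact_fun_bilinear u' : bilinear_for (GRing.Scale.Law.clone _ _ *:%R _)
  (GRing.Scale.Law.clone _ _ *:%R _) (Uact_fun u').
Proof.
split=> [a | u] c x y; rewrite /Uact_fun; first by rewrite mulrDl -scalerAl.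
by rewrite linearPr mulrDl -scalerAl linearP mulrDr -scalerAr.
Qed.

HB.instance Definition _ u' :=
  bilinear_isBilinear.Build k U A U *:%R *:%R (Uact_fun u') (Uact_fun_bilinear u').

Definition Uact (h : H) (u' : U) : U := tlift (Uact_fun u') h.

Fact Uact_tens u a u' : Uact (u *t a) u' = u * id_chi ((1 *t a) * (u' *t 1)).
Proof. exact: tliftE. Qed.

Fact id_chi_mull u h : id_chi ((u *t 1) * h) = u * id_chi h.
Proof.
move: h; apply: tens_ext => [c x y | c x y | u' a].
- by rewrite mulrDr -scalerAr linearP.
- by rewrite linearP mulrDr -scalerAr.
- by rewrite tensM ?mul1r ?tensrE /= ?scalerAr //; left.
Qed.

Fact id_chi_mulr h a : id_chi (h * (1 *t a)) = (chi a : k) *: id_chi h.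
Proof.
move: h; apply: tens_ext => [c x y | c x y | u' a'].
- by rewrite mulrDl -scalerAl linearP.
- by rewrite linearP scalerDr !scalerA mulrC.
- by rewrite tensM ?mulr1 ?tensrE ?rmorphM /= ?scalerA 1?mulrC //; right.
Qed.

Fact UactE h u : Uact h u = id_chi (h * (u *t 1)).
Proof.
move: h; apply: tens_ext => [c x y | c x y | u' a].
- exact: linearP.
- by rewrite mulrDl -scalerAl linearP.
- rewrite Uact_tens -id_chi_mull mulrA tensM ?mul1r ?mulr1 //; by left.
Qed.

Fact id_chi_mul h h' : id_chi (h * (id_chi h' *t 1)) = id_chi (h * h').
Proof.
move: h'; apply: tens_ext => [c x y | c x y | u a].
- by rewrite linearP linearPl mulrDr -scalerAr linearP.
- by rewrite mulrDr -scalerAr linearP.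
- rewrite tensrE /= linearZl_LR -scalerAr linearZ /= -id_chi_mulr -mulrA tensM.
    by rewrite mul1r mulr1.
  by left.
Qed.

Fact UactA h h' u : Uact h (Uact h' u) = Uact (h * h') u.
Proof. by rewrite !UactE id_chi_mul mulrA. Qed.
Fact Uact1 : left_id 1 Uact.
Proof.
by move=> u; rewrite UactE mul1r tensrE /= rmorph1 scale1r.
Qed.
Fact UactDr : right_distributive Uact +%R.
Proof. by move=> h u v; rewrite !UactE linearDl mulrDr linearD. Qed.
Fact UactDl u : {morph Uact^~ u : h h' / h + h'}.
Proof. by move=> h h'; rewrite !UactE mulrDl linearD. Qed.

Local Notation Uchi := (U_chi H chi).

HB.instance Definition _ := GRing.Zmodule.copy Uchi U.
HB.instance Definition _ :=
  GRing.Zmodule_isLmodule.Build H Uchi UactA Uact1 UactDr UactDl.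

(* The two [k]-structures of [Uchi] agree. *)
Fact Uchi_scale (c : k) (u : U) : (c%:A : H) *: (u : Uchi) = c *: u :> U.
Proof.
rewrite -[LHS]/(Uact _ _) UactE -scalerAl mul1r linearZ /= tensrE.
by rewrite rmorph1 scale1r.
Qed.

Fact Uact_linear (h : H) : linear (Uact h : U -> U).
Proof.
by move=> c u v; rewrite !UactE linearPl mulrDr -scalerAr linearP.
Qed.

Local Notation Ustar := (Udual H chi).

HB.instance Definition _ := GRing.Zmodule.copy Ustar (dual U).

Definition Udual_act_fun (h : H^c) (f : Ustar) (u : U) : k^o := (f : dual U) (Uact h u).

Fact Udual_act_linear h f : linear (Udual_act_fun h f).
Proof.
move=> c u v; rewrite /Udual_act_fun Uact_linear.
exact: (linearP (f : {linear U -> k^o})).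
Qed.

HB.instance Definition _ h f :=
  GRing.isLinear.Build k U k^o *:%R (Udual_act_fun h f) (Udual_act_linear h f).

Definition Udual_act (h : H^c) (f : Ustar) : Ustar :=
  Udual_act_fun h f : {linear U -> k^o}.

Fact Udual_actA h h' f : Udual_act h (Udual_act h' f) = Udual_act (h * h') f.
Proof.
by apply: dualP => u; rewrite /= /Udual_act_fun /= /Udual_act_fun UactA.
Qed.
Fact Udual_act1 : left_id 1 Udual_act.
Proof. by move=> f; apply: dualP => u; rewrite /= /Udual_act_fun Uact1. Qed.
Fact Udual_actDr : right_distributive Udual_act +%R.
Proof. by move=> h f g; apply: dualP. Qed.
Fact Udual_actDl f : {morph Udual_act^~ f : h h' / h + h'}.
Proof.
move=> h h'; apply: dualP => u; rewrite /= /Udual_act_fun UactDl.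
exact: (linearD (f : {linear U -> k^o})).
Qed.

HB.instance Definition _ := GRing.Zmodule_isLmodule.Build H^c Ustar
  Udual_actA Udual_act1 Udual_actDr Udual_actDl.

End LeftModule.
Section RightModule.
Variable rho : {lrmorphism U -> k^o}.

Local Notation rho_id := (tensl rho (idfun : {linear A -> A})).

Definition Aact_fun (a : A) (u : U) (a' : A) : A := rho_id ((1 *t a) * (u *t 1)) * a'.

Fact Aact_fun_bilinear a : bilinear_for (GRing.Scale.Law.clone _ _ *:%R _)
  (GRing.Scale.Law.clone _ _ *:%R _) (Aact_fun a).
Proof.
split=> [a' | u] c x y; rewrite /Aact_fun; last by rewrite mulrDr -scalerAr.
by rewrite linearPl mulrDr -scalerAr linearP mulrDl -scalerAl.
Qed.

HB.instance Definition _ a :=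
  bilinear_isBilinear.Build k U A A *:%R *:%R (Aact_fun a) (Aact_fun_bilinear a).

Definition Aact (a : A) (h : H) : A := tlift (Aact_fun a) h.

Fact Aact_tens a u a' : Aact a (u *t a') = rho_id ((1 *t a) * (u *t 1)) * a'.
Proof. exact: tliftE. Qed.

Fact rho_id_mulr h a : rho_id (h * (1 *t a)) = rho_id h * a.
Proof.
move: h; apply: tens_ext => [c x y | c x y | u a'].
- by rewrite mulrDl -scalerAl linearP.
- by rewrite linearP mulrDl -scalerAl.
- by rewrite tensM ?mulr1 ?tenslE /= ?scalerAl //; right.
Qed.

Fact rho_id_mull h u : rho_id ((u *t 1) * h) = (rho u : k) *: rho_id h.
Proof.
move: h; apply: tens_ext => [c x y | c x y | u' a].
- by rewrite mulrDr -scalerAr linearP.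
- by rewrite linearP scalerDr !scalerA mulrC.
- by rewrite tensM ?mul1r ?tenslE ?rmorphM /= ?scalerA //; left.
Qed.

Fact AactE a h : Aact a h = rho_id ((1 *t a) * h).
Proof.
move: h; apply: tens_ext => [c x y | c x y | u a'].
- exact: linearP.
- by rewrite mulrDr -scalerAr linearP.
- rewrite Aact_tens -rho_id_mulr -mulrA tensM ?mul1r ?mulr1 //; by left.
Qed.

Fact rho_id_mul h h' : rho_id ((1 *t rho_id h) * h') = rho_id (h * h').
Proof.
move: h; apply: tens_ext => [c x y | c x y | u a].
- by rewrite linearP linearPr mulrDl -scalerAl linearP.
- by rewrite mulrDl -scalerAl linearP.
- rewrite tenslE /= linearZr_LR -scalerAl linearZ /= -rho_id_mull mulrA tensM.
    by rewrite mul1r mulr1.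
  by left.
Qed.

Local Notation Arho := (A_rho H rho).

HB.instance Definition _ := GRing.Zmodule.copy Arho A.

Definition Aact_op (h : H^c) (a : Arho) : Arho := Aact a h.

Fact Aact_opA h h' a : Aact_op h (Aact_op h' a) = Aact_op (h * h') a.
Proof. by rewrite /Aact_op !AactE rho_id_mul mulrA. Qed.
Fact Aact_op1 : left_id 1 Aact_op.
Proof.
by move=> a; rewrite /Aact_op AactE mulr1 tenslE /= rmorph1 scale1r.
Qed.
Fact Aact_opDr : right_distributive Aact_op +%R.
Proof. by move=> h a b; rewrite /Aact_op !AactE linearDr mulrDl linearD. Qed.
Fact Aact_opDl a : {morph Aact_op^~ a : h h' / h + h'}.
Proof. by move=> h h'; rewrite /Aact_op !AactE mulrDr linearD. Qed.

HB.instance Definition _ := GRing.Zmodule_isLmodule.Build H^c Arho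
  Aact_opA Aact_op1 Aact_opDr Aact_opDl.

(* The two [k]-structures of [Arho] agree. *)
Fact Arho_scale (c : k) (a : A) : ract (a : Arho) (c%:A : H) = c *: a :> A.
Proof.
rewrite -[LHS]/(Aact _ _) AactE -scalerAr mulr1 linearZ /= tenslE.
by rewrite rmorph1 scale1r.
Qed.

Fact Aact_linear (h : H) : linear (Aact^~ h : A -> A).
Proof.
by move=> c a b; rewrite !AactE linearPr mulrDl -scalerAl linearP.
Qed.

Local Notation Astar := (Adual H rho).

HB.instance Definition _ := GRing.Zmodule.copy Astar (dual A).

Definition Adual_act_fun (h : H) (f : Astar) (a : A) : k^o := (f : dual A) (Aact a h).

Fact Adual_act_linear h f : linear (Adual_act_fun h f).
Proof.
move=> c a b; rewrite /Adual_act_fun Aact_linear.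
exact: (linearP (f : {linear A -> k^o})).
Qed.

HB.instance Definition _ h f :=
  GRing.isLinear.Build k A k^o *:%R (Adual_act_fun h f) (Adual_act_linear h f).

Definition Adual_act (h : H) (f : Astar) : Astar :=
  Adual_act_fun h f : {linear A -> k^o}.

Fact Adual_actA h h' f : Adual_act h (Adual_act h' f) = Adual_act (h * h') f.
Proof.
by apply: dualP => a; exact: (congr1 (f : dual A) (Aact_opA h' h a)).
Qed.
Fact Adual_act1 : left_id 1 Adual_act.
Proof.
by move=> f; apply: dualP => a; rewrite /= /Adual_act_fun -[Aact a 1]/(Aact_op 1 a) Aact_op1.
Qed.
Fact Adual_actDr : right_distributive Adual_act +%R.
Proof. by move=> h f g; apply: dualP. Qed.
Fact Adual_actDl f : {morph Adual_act^~ f : h h' / h + h'}.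
Proof.
move=> h h'; apply: dualP => a; rewrite /= /Adual_act_fun.
rewrite -[Aact a (h + h')]/(Aact_op (h + h') a) Aact_opDl.
exact: (linearD (f : {linear A -> k^o})).
Qed.

HB.instance Definition _ := GRing.Zmodule_isLmodule.Build H Astar
  Adual_actA Adual_act1 Adual_actDr Adual_actDl.

End RightModule.

Variables (rho : {lrmorphism U -> k^o}) (chi : {lrmorphism A -> k^o}).

Definition rho_chi : {linear H -> k^o} := tensl rho chi.

Definition Psi (a : A) (u : U) : k^o := rho_chi ((1 *t a) * (u *t 1)).

Fact Psi_bilinear : bilinear_for (GRing.Scale.Law.clone _ _ *:%R _)
  (GRing.Scale.Law.clone _ _ *:%R _) Psi.
Proof.
split=> [u | a] c x y; rewrite /Psi; first by rewrite linearPr mulrDl -scalerAl linearP.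
by rewrite linearPl mulrDr -scalerAr linearP.
Qed.

HB.instance Definition _ :=
  bilinear_isBilinear.Build k A U k^o *:%R *:%R Psi Psi_bilinear.

Definition Psi_l : A -> dual U := curryl Psi.
Definition Psi_r : U -> dual A := curryr Psi.

Definition Aperp : {pred U} := fun u => `[< forall a, Psi a u = 0 >].
Definition Uperp : {pred A} := fun a => `[< forall u, Psi a u = 0 >].

Definition I_rho_chi : submodClosed (U_chi H chi) :=
  submod_sum (fun N : submodClosed (U_chi H chi) =>
    forall u : U, u \in N -> rho u = 0).
Definition J_chi_rho : submodClosed (A_rho H rho) :=
  submod_sum (fun N : submodClosed (A_rho H rho) =>
    forall a : A, a \in N -> chi a = 0).

Definition L_rho_chi : lmodType H := quot_module I_rho_chi.
Definition R_chi_rho : lmodType H^c := quot_module J_chi_rho.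

Definition pi_L : {linear U_chi H chi -> L_rho_chi} := quot_pi I_rho_chi.
Definition pi_R : {linear A_rho H rho -> R_chi_rho} := quot_pi J_chi_rho.

(* [u .rho chi] and [rho .chi a] *)
Definition act_chi (u : U) : Adual H rho :=
  (u *t 1) *: ((chi : {linear A -> k^o}) : Adual H rho).
Definition rho_act (a : A) : Udual H chi :=
  ract ((rho : {linear U -> k^o}) : Udual H chi) (1 *t a).

Definition U_dot_chi : {pred Adual H rho} :=
  fun f => `[< exists u, f = act_chi u >].
Definition rho_dot_A : {pred Udual H chi} :=
  fun f => `[< exists a, f = rho_act a >].

End TensorAlgebra.

Arguments U_dot_chi {k U A} H rho chi _.
Arguments rho_dot_A {k U A} H rho chi _.

(* Main.v *)
(* Since (id (x) chi)(h (u (x) 1)) = h .chi u and (rho (x) id)((1 (x) a) h) =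
   a .rho h, both Psi(a .rho h, u) and Psi(a, h .chi u) equal
   (rho (x) chi)((1 (x) a) h (u (x) 1)), so Psi is H-balanced and Psi_r, Psi_l
   are H-linear with kernels A^perp, U^perp. As Psi(1, -) = rho and
   Psi(a, u) = rho((1 (x) a) .chi u), the submodule A^perp lies in Ker rho and
   contains every submodule that does; likewise for U^perp and chi. *)
Require Import Defs.
From HB Require Import structures.
From mathcomp Require Import all_boot all_algebra.
From mathcomp Require Import boolp.

Set Implicit Arguments.
Unset Strict Implicit.
Unset Printing Implicit Defensive.

Import GRing.Theory.
Local Open Scope ring_scope.

(** * Quotients by kernels, and sums of submodules *)

Section QuotientIsomorphism.
Variables (R : pzRingType) (M N : lmodType R) (S : submodClosed M).

(** Maps out of the quotient are defined below on chosen representatives; this controls the error of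
    that choice and so lets them be evaluated on the class of any [x]. *)
Lemma repr_quot_pi (x : M) :
  exists2 y, y \in S & generic_quotient.repr (quot_pi S x) = x + y.
Proof.
exists (generic_quotient.repr (quot_pi S x) - x); last by rewrite addrC subrK.
by rewrite -quot_pi_eq quot_piK.
Qed.

Lemma kernel_closed (Q : {pred M}) (g : {linear M -> N}) :
  (forall x, x \in Q <-> g x = 0) -> subsemimod_closed Q.
Proof.
move=> kerg; split; first split.
- by apply/kerg; exact: linear0.
- by move=> x y /kerg gx /kerg gy; apply/kerg; rewrite linearD gx gy addr0.
- by move=> h x /kerg gx; apply/kerg; rewrite linearZ /= gx scaler0.
Qed.

(** First isomorphism theorem, with the kernel and the image of [g] given only by membership in [S]
    and [T]; that [T] is a submodule then follows. *)
Lemma quot_iso_onto (T : {pred N}) (g : {linear M -> N}) :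
    (forall x, x \in S <-> g x = 0) ->
    (forall y, y \in T <-> exists x, g x = y) ->
  exists2 f : {linear quot_module S -> N}, lmod_iso_onto T f &
    forall x, f (quot_pi S x) = g x.
Proof.
move=> kerg img.
pose f0 (q : quot_module S) : N := g (generic_quotient.repr q).
have f0pi x : f0 (quot_pi S x) = g x.
  rewrite /f0; have [y /kerg gy ->] := repr_quot_pi x.
  by rewrite linearD gy addr0.
have f0L : linear f0.
  move=> c p q; rewrite -[p]quot_piK -[q]quot_piK -linearP !f0pi.
  exact: linearP.
pose f : {linear quot_module S -> N} :=
  HB.pack f0 (GRing.isLinear.Build _ _ _ _ f0 f0L).
exists f => //; split.
- split; first by apply/img; exists 0; rewrite linear0.
  move=> c x y /img[x' <-] /img[y' <-]; apply/img.
  by exists (c *: x' + y'); rewrite linearP.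
- move=> p q; rewrite -[p]quot_piK -[q]quot_piK.
  move: (generic_quotient.repr p) (generic_quotient.repr q) => x y.
  rewrite [f _]f0pi [f _]f0pi => gxy.
  by apply/eqP; rewrite quot_pi_eq; apply/kerg; rewrite linearB gxy subrr.
- move=> y; split=> [/img[x <-]|[q <-]]; first by exists (quot_pi S x); exact: f0pi.
  by apply/img; exists (generic_quotient.repr q).
Qed.

(** [Q] is itself one of the summands, and every other summand lies in [Q], which is closed under
    finite sums. *)
Lemma submod_sum_largest (P : M -> Prop) (Q : submodClosed M) :
    (forall x, x \in Q -> P x) ->
    (forall L : submodClosed M, (forall x, x \in L -> P x) ->
       {subset L <= Q}) ->
  Q =i submod_sum (fun L : submodClosed M => forall x, x \in L -> P x).
Proof.
move=> QP LQ x; apply/idP/asboolP => [Qx | [s [sL ->]]].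
- exists [:: x]; rewrite big_seq1; split=> // y; rewrite inE => /eqP ->.
  by exists Q.
- rewrite big_seq; apply: rpred_sum => y /sL[L LP Ly]; exact: LQ Ly.
Qed.

End QuotientIsomorphism.

(** * The form [Psi]: its link to the actions, balancedness, [H]-linearity *)

Section BalancedForm.
Variables (k : fieldType) (U A : algType k) (H : tensor_algebra U A).
Variables (chi : {lrmorphism A -> k^o}) (rho : {lrmorphism U -> k^o}).

Local Notation "u *t a" := (tens H u a) (at level 40).
Local Notation Psi := (Psi H rho chi).
Local Notation Uchi := (U_chi H chi).
Local Notation Arho := (A_rho H rho).

(** Both sides are linear in [h], and on a pure tensor both give the product of [rho u] and
    [chi a]. *)
Lemma rho_id_chi (h : H) :
  rho (tensr H (idfun : {linear U -> U}) chi h) = rho_chi H rho chi h.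
Proof.
move: h; apply: tens_ext => [c x y | c x y | u a]; rewrite ?linearP //.
by rewrite tensrE /rho_chi tenslE linearZ; exact: mulrC.
Qed.

Lemma chi_rho_id (h : H) :
  chi (tensl H rho (idfun : {linear A -> A}) h) = rho_chi H rho chi h.
Proof.
move: h; apply: tens_ext => [c x y | c x y | u a]; rewrite ?linearP //.
by rewrite !tenslE linearZ.
Qed.

Lemma rho_Uact (h : H) (u : U) :
  rho (h *: (u : Uchi)) = rho_chi H rho chi (h * (u *t 1)).
Proof. by rewrite -rho_id_chi -UactE. Qed.

Lemma chi_Aact (a : A) (h : H) :
  chi (ract (a : Arho) h) = rho_chi H rho chi ((1 *t a) * h).
Proof. by rewrite -chi_rho_id -AactE. Qed.

Lemma Psi_rho (a : A) (u : U) : Psi a u = rho ((1 *t a) *: (u : Uchi)).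
Proof. by rewrite rho_Uact. Qed.

Lemma Psi_chi (a : A) (u : U) : Psi a u = chi (ract (a : Arho) (u *t 1)).
Proof. by rewrite chi_Aact. Qed.

Lemma Psi1u (u : U) : Psi 1 u = rho u.
Proof. by rewrite Psi_rho tens1 scale1r. Qed.

Lemma Psia1 (a : A) : Psi a 1 = chi a.
Proof. by rewrite Psi_chi tens1 [ract _ _]scale1r. Qed.

Lemma Psi_balanced : balanced (X := Arho) (Y := Uchi) Psi.
Proof.
move=> a h u; rewrite Psi_chi [RHS]Psi_rho.
(* The right action is scaling over [H^c], whose reversed product turns [scalerA] into the
   associativity law of a right module. *)
have -> : ract (ract (a : Arho) h : Arho) (u *t 1) =
          ract (a : Arho) (h * (u *t 1)) by exact: (scalerA (_ : H^c)).
by rewrite scalerA rho_Uact chi_Aact mulrA.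
Qed.

Lemma Psi_r_act (u : U) : Psi_r H rho chi u = act_chi H rho chi u.
Proof. by apply: dualP => a; exact: Psi_chi. Qed.

Lemma Psi_l_act (a : A) : Psi_l H rho chi a = rho_act H rho chi a.
Proof. by apply: dualP => u; exact: Psi_rho. Qed.

(* Psi_r and Psi_l retyped between the H-modules, so that they carry H-linear
   structures. *)
Definition Psi_r_mod : Uchi -> Adual H rho := Psi_r H rho chi.
Definition Psi_l_mod : Arho -> Udual H chi := Psi_l H rho chi.

(** [H]-linearity is balancedness read backwards: the value of [h *: Psi_r_mod u] at [a] is [Psi] at
    [ract a h] and [u]. *)
Lemma Psi_r_linear : linear Psi_r_mod.
Proof.
move=> h u v; apply: dualP => a; rewrite [LHS](linearDr Psi).
by congr (_ + _); apply/esym/Psi_balanced.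
Qed.

Lemma Psi_l_linear : linear Psi_l_mod.
Proof.
move=> h a b; apply: dualP => u; rewrite [LHS](linearDl Psi).
by congr (_ + _); apply: Psi_balanced.
Qed.

HB.instance Definition _ :=
  GRing.isLinear.Build H Uchi (Adual H rho) *:%R Psi_r_mod Psi_r_linear.
HB.instance Definition _ :=
  GRing.isLinear.Build H^c Arho (Udual H chi) *:%R Psi_l_mod Psi_l_linear.

(** * The two annihilators of [Psi] as kernels and as largest submodules *)

Lemma Aperp_ker (u : Uchi) : u \in Aperp H rho chi <-> Psi_r_mod u = 0.
Proof.
split=> [/asboolP Pu | Pu]; first by apply: dualP => a; exact: Pu.
by apply/asboolP => a; exact: (congr1 (fun f : dual A => f a) Pu).
Qed.

Lemma Uperp_ker (a : Arho) : a \in Uperp H rho chi <-> Psi_l_mod a = 0.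
Proof.
split=> [/asboolP Pa | Pa]; first by apply: dualP => u; exact: Pa.
by apply/asboolP => u; exact: (congr1 (fun f : dual U => f u) Pa).
Qed.

Lemma AperpE : Aperp H rho chi =i I_rho_chi H rho chi.
Proof.
pose Q : submodClosed Uchi := HB.pack (Aperp H rho chi : {pred Uchi})
  (GRing.isSubSemiModClosed.Build H Uchi (Aperp H rho chi) (kernel_closed Aperp_ker)).
apply: (@submod_sum_largest H Uchi (fun u => rho u = 0) Q).
- by move=> u /asboolP Pu; rewrite -Psi1u.
(* [N] is stable under the action of [1 *t a], so [rho] still vanishes on the translate of [u]. *)
- move=> N Nrho u Nu; apply/asboolP => a; rewrite Psi_rho.
  by apply: Nrho; exact: rpredZ.
Qed.

Lemma UperpE : Uperp H rho chi =i J_chi_rho H rho chi.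
Proof.
pose Q : submodClosed Arho := HB.pack (Uperp H rho chi : {pred Arho})
  (GRing.isSubSemiModClosed.Build H^c Arho (Uperp H rho chi) (kernel_closed Uperp_ker)).
apply: (@submod_sum_largest H^c Arho (fun a => chi a = 0) Q).
- by move=> a /asboolP Pa; rewrite -Psia1.
- move=> N Nchi a Na; apply/asboolP => u; rewrite Psi_chi.
  by apply: Nchi; exact: rpredZ.
Qed.

(** * The induced form on the quotients *)

Local Notation Rq := (R_chi_rho H rho chi).
Local Notation Lq := (L_rho_chi H rho chi).
Local Notation Rk := (restr (@in_algc k H) Rq).
Local Notation Lk := (restr (in_alg H) Lq).

(** The quotients carry only [H]-structures, so bilinearity over [k] refers to scalars restricted
    along the map sending [c] to [c%:A]. *)
Definition Psi_bar (r : Rk) (l : Lk) : k^o :=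
  Psi (generic_quotient.repr (r : Rq)) (generic_quotient.repr (l : Lq)).

(** Another choice of representatives adds elements of [J_chi_rho] and [I_rho_chi], that is of
    [Uperp] and [Aperp], which [Psi] kills. *)
Lemma Psi_bar_pi (a : A) (u : U) :
  Psi_bar (pi_R H rho chi a) (pi_L H rho chi u) = Psi a u.
Proof.
rewrite /Psi_bar.
have [b + ->] := repr_quot_pi (J_chi_rho H rho chi) a.
have [v + ->] := repr_quot_pi (I_rho_chi H rho chi) u.
rewrite -AperpE -UperpE => /asboolP Pv /asboolP Pb.
rewrite [LHS](linearDl Psi) [X in _ + X]Pb addr0.
by rewrite [LHS](linearDr Psi) [X in _ + X]Pv addr0.
Qed.

(** Reconciles the restricted scalars on the quotient with the original ones on [A]: by
    [Arho_scale], [c%:A] acts on [A_rho] as [c]. *)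
Lemma pi_R_restr (c : k) (a b : A) :
  c *: (pi_R H rho chi a : Rk) + (pi_R H rho chi b : Rk) =
  pi_R H rho chi (c *: a + b).
Proof.
transitivity (pi_R H rho chi (in_algc H c *: (a : Arho) + (b : Arho))).
  by rewrite linearP.
by congr (pi_R H rho chi (_ + b)); exact: Arho_scale.
Qed.

Lemma pi_L_restr (c : k) (u v : U) :
  c *: (pi_L H rho chi u : Lk) + (pi_L H rho chi v : Lk) =
  pi_L H rho chi (c *: u + v).
Proof.
transitivity (pi_L H rho chi ((c%:A : H) *: (u : Uchi) + (v : Uchi))).
  by rewrite linearP.
by congr (pi_L H rho chi (_ + v)); exact: Uchi_scale.
Qed.

Lemma pi_R_surj (r : Rk) : exists a : A, r = pi_R H rho chi a.
Proof. by exists (generic_quotient.repr (r : Rq)); rewrite [RHS]quot_piK. Qed.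

Lemma pi_L_surj (l : Lk) : exists u : U, l = pi_L H rho chi u.
Proof. by exists (generic_quotient.repr (l : Lq)); rewrite [RHS]quot_piK. Qed.

Lemma Psi_bar_bilinear : bilinear_for (GRing.Scale.Law.clone _ _ *:%R _)
  (GRing.Scale.Law.clone _ _ *:%R _) Psi_bar.
Proof.
split=> [l | r] c x y.
- have [[[u ->] [a ->]] [b ->]] := (pi_L_surj l, pi_R_surj x, pi_R_surj y).
  rewrite [X in Psi_bar^~ _ X]pi_R_restr !Psi_bar_pi; exact: (linearPl Psi).
- have [[[a ->] [u ->]] [v ->]] := (pi_R_surj r, pi_L_surj x, pi_L_surj y).
  rewrite [X in Psi_bar _ X]pi_L_restr !Psi_bar_pi; exact: (linearPr Psi).
Qed.

HB.instance Definition _ :=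
  bilinear_isBilinear.Build k Rk Lk k^o *:%R *:%R Psi_bar Psi_bar_bilinear.

Lemma Psi_bar_nonsingular : nonsingular Psi_bar.
Proof.
split=> x y Exy.
- have [[a Ea] [b Eb]] := (pi_R_surj x, pi_R_surj y).
  rewrite {}Ea {}Eb in Exy *.
  (* Equality of the two classes means that [a - b] lies in [J_chi_rho], hence in [Uperp], which can
     be tested against each [u]. *)
  apply/eqP; rewrite [_ == _]quot_pi_eq -UperpE; apply/asboolP => u.
  have /(congr1 (fun f : dual Lk => f (pi_L H rho chi u))) := Exy.
  rewrite /= [LHS]Psi_bar_pi [RHS]Psi_bar_pi => E.
  by rewrite [LHS](linearBl Psi) [X in X - _]E; exact: subrr.
- have [[u Eu] [v Ev]] := (pi_L_surj x, pi_L_surj y).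
  rewrite {}Eu {}Ev in Exy *.
  apply/eqP; rewrite [_ == _]quot_pi_eq -AperpE; apply/asboolP => a.
  have /(congr1 (fun f : dual Rk => f (pi_R H rho chi a))) := Exy.
  rewrite /= [LHS]Psi_bar_pi [RHS]Psi_bar_pi => E.
  by rewrite [LHS](linearBr Psi) [X in X - _]E; exact: subrr.
Qed.

Lemma Psi_bar_balanced : balanced (X := Rq) (Y := Lq) Psi_bar.
Proof.
move=> r h l; have [[a ->] [u ->]] := (pi_R_surj r, pi_L_surj l).
have -> : ract (pi_R H rho chi a) h = pi_R H rho chi (ract (a : Arho) h).
  by rewrite /ract linearZ.
by rewrite -linearZ !Psi_bar_pi Psi_balanced.
Qed.

(** * The images of [Psi_r] and [Psi_l], and the assembled result *)

Lemma Psi_r_onto (f : Adual H rho) :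
  f \in U_dot_chi H rho chi <-> exists u, Psi_r_mod u = f.
Proof.
split=> [/asboolP[u ->] | [u <-]]; first by exists u; exact: Psi_r_act.
by apply/asboolP; exists u; exact: Psi_r_act.
Qed.

Lemma Psi_l_onto (f : Udual H chi) :
  f \in rho_dot_A H rho chi <-> exists a, Psi_l_mod a = f.
Proof.
split=> [/asboolP[a ->] | [a <-]]; first by exists a; exact: Psi_l_act.
by apply/asboolP; exists a; exact: Psi_l_act.
Qed.

End BalancedForm.

Theorem proposition2p6 (k : fieldType) (U A : algType k)
    (H : tensor_algebra U A)
    (chi : {lrmorphism A -> k^o}) (rho : {lrmorphism U -> k^o}) :
  (* a *)
  (forall (a : A) (u : U),
     Psi H rho chi a u = rho (tens H 1 a *: (u : U_chi H chi)) /\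
     Psi H rho chi a u = chi (ract (a : A_rho H rho) (tens H u 1))) /\
  (* b *)
  balanced (X := A_rho H rho) (Y := U_chi H chi) (Psi H rho chi) /\
  (* c *)
  (Aperp H rho chi =i I_rho_chi H rho chi /\
   (exists2 S : submodClosed (U_chi H chi), S =i Aperp H rho chi &
      quot_module S = L_rho_chi H rho chi :> lmodType H) /\
   (exists2 f : {linear L_rho_chi H rho chi -> Adual H rho},
      lmod_iso_onto (U_dot_chi H rho chi) f &
      forall u : U, f (pi_L H rho chi u) = Psi_r H rho chi u /\
                    Psi_r H rho chi u = act_chi H rho chi u)) /\
  (* d *)
  (Uperp H rho chi =i J_chi_rho H rho chi /\
   (exists2 S : submodClosed (A_rho H rho), S =i Uperp H rho chi &
      quot_module S = R_chi_rho H rho chi :> lmodType H^c) /\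
   (exists2 f : {linear R_chi_rho H rho chi -> Udual H chi},
      lmod_iso_onto (rho_dot_A H rho chi) f &
      forall a : A, f (pi_R H rho chi a) = Psi_l H rho chi a /\
                    Psi_l H rho chi a = rho_act H rho chi a)) /\
  (* e *)
  (exists Psibar : {bilinear restr (@in_algc k H) (R_chi_rho H rho chi)
                      -> restr (in_alg H) (L_rho_chi H rho chi) -> k^o},
     [/\ nonsingular Psibar,
         balanced (X := R_chi_rho H rho chi) (Y := L_rho_chi H rho chi) Psibar,
         forall (a : A) (u : U),
           Psibar (pi_R H rho chi a) (pi_L H rho chi u) = Psi H rho chi a u &
         forall beta : {bilinear restr (@in_algc k H) (R_chi_rho H rho chi)
                          -> restr (in_alg H) (L_rho_chi H rho chi) -> k^o},
           (forall (a : A) (u : U),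
              beta (pi_R H rho chi a) (pi_L H rho chi u) = Psi H rho chi a u) ->
           beta =2 Psibar]).
Proof.
split; first by move=> a u; split; [exact: Psi_rho | exact: Psi_chi].
split; first exact: Psi_balanced.
split; [| split].
- split; first exact: AperpE.
  split; first by exists (I_rho_chi H rho chi) => // u; rewrite AperpE.
  (* [L_rho_chi] is the quotient by [I_rho_chi], so the kernel of [Psi_r_mod] has to be expressed
     through it instead of [Aperp]. *)
  have kerI (u : U_chi H chi) :
      u \in I_rho_chi H rho chi <-> Psi_r_mod rho u = 0.
    by rewrite -AperpE; exact: Aperp_ker.
  have [f iso_f fE] := quot_iso_onto kerI (@Psi_r_onto _ _ _ H chi rho).
  by exists f => // u; split; [exact: fE | exact: Psi_r_act].
- split; first exact: UperpE.
  split; first by exists (J_chi_rho H rho chi) => // a; rewrite UperpE.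
  have kerJ (a : A_rho H rho) :
      a \in J_chi_rho H rho chi <-> Psi_l_mod chi a = 0.
    by rewrite -UperpE; exact: Uperp_ker.
  have [f iso_f fE] := quot_iso_onto kerJ (@Psi_l_onto _ _ _ H chi rho).
  by exists f => // a; split; [exact: fE | exact: Psi_l_act].
- exists (@Psi_bar _ _ _ H chi rho); split.
  + exact: Psi_bar_nonsingular.
  + exact: Psi_bar_balanced.
  + exact: Psi_bar_pi.
  (* Uniqueness: the projections are onto, so the values on projected pairs determine the form. *)
  + move=> beta betaE r l.
    have [[a ->] [u ->]] := (pi_R_surj r, pi_L_surj l).
    by rewrite betaE [RHS]Psi_bar_pi.
Qed.
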